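(* Let $Q$ denote the incompatibility, as defined in the context, of a set of observables acting on a Hilbert space $\mathcal{H}_d$ of dimension $d$. Then $Q=0$ if the observables commute, and $Q>0$ if the observables do not commute.
   Context: Observables are Hermitian operators on the complex Hilbert space $\mathcal{H}_d$ of finite dimension $d$. Let $\Pi=\{\Pi^1,\dots,\Pi^N\}$ be a set of $N$ noncommuting observables, meaning that no two distinct members commute (for $N=1$ the set consists of a single observable). Let $|\psi^i_j\rangle$ be the $j$-th eigenvector of $\Pi^i$, $j=1,\dots,d$, where for each $i$ these eigenvectors form an orthonormal basis of $\mathcal{H}_d$, and let $\Pi^i_j=|\psi^i_j\rangle\langle\psi^i_j|$. The signal ensemble is $S(\Pi)=\{\Pi^i_j\}$ with $i=1,\dots,N$ and $j=1,\dots,d$, each state having probability $1/(Nd)$. For a measurement (POVM) $\mathbf{M}=\{M_a\}$ on $\mathcal{H}_d$ (positive semidefinite operators with $\sum_a M_a=\mathbb{I}$) and a state reconstruction map $\mathbf{A}:a\mapsto\sigma_a$ assigning to each outcome $a$ a quantum state (density matrix) $\sigma_a$ on $\mathcal{H}_d$, the average fidelity is $$F_{S(\Pi)}(\mathbf{M},\mathbf{A})=\frac{1}{Nd}\sum_{i,j,a}\mathrm{Tr}(\Pi^i_jM_a)\,\mathrm{Tr}(\Pi^i_j\sigma_a).$$ The optimal fidelity is $F_{S(\Pi)}=\sup_{\mathbf{M}}\sup_{\mathbf{A}}F_{S(\Pi)}(\mathbf{M},\mathbf{A})$, and the incompatibility of $\Pi$ is $Q(\Pi)=1-F_{S(\Pi)}$.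 For a general set $\mathfrak{S}$ of $\mathfrak{N}$ observables, some of which may commute, one constructs a minimal noncommuting subset: a subset $\Pi\subseteq\mathfrak{S}$ of $N\le\mathfrak{N}$ noncommuting observables such that every observable of $\mathfrak{S}$ not in $\Pi$ commutes with at least one observable in $\Pi$. The case $N=1$ is taken to mean that all observables in $\mathfrak{S}$ commute with each other, and $N=\mathfrak{N}$ that all observables in $\mathfrak{S}$ are noncommuting. The incompatibility $Q$ of $\mathfrak{S}$ is defined as $Q(\Pi)$ for the minimal noncommuting subset $\Pi$ obtained in this way. *)

(* Defs.v *)
From mathcomp Require Import all_boot all_order all_algebra finmap.
From mathcomp Require Import sesquilinear spectral complex.
From mathcomp Require Import classical_sets reals.

Set Implicit Arguments.
Unset Strict Implicit.
Unset Printing Implicit Defensive.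

Import Order.TTheory GRing.Theory Num.Theory.

Local Open Scope ring_scope.
Local Open Scope complex_scope.
Local Open Scope sesquilinear_scope.
Local Open Scope fset_scope.

(* The Hilbert space of dimension d is C^d, C = R[i] for R : realType, with   *)
(* vectors written as columns; [M ^t*] is the conjugate transpose.            *)

Definition observables (R : realType) (d : nat) (S : {fset 'M[R[i]]_d}) : Prop :=
  forall A, A \in S -> A \is hermsymmx.

Definition commuting (R : realType) (d : nat) (S : {fset 'M[R[i]]_d}) : Prop :=
  forall A B, A \in S -> B \in S -> comm_mx A B.

Definition noncommuting (R : realType) (d : nat) (S : {fset 'M[R[i]]_d}) : Prop :=
  forall A B, A \in S -> B \in S -> A != B -> ~ comm_mx A B.

(* The last clause is the convention that N = 1 is reserved for commuting S.  *)
(* It excludes, for instance, {C} as a choice for {A, B, C} when C commutes   *)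
(* with both A and B while A and B do not commute.                            *)
Definition minimal_noncommuting_subset (R : realType) (d : nat)
    (S Pi : {fset 'M[R[i]]_d}) : Prop :=
  [/\ Pi `<=` S,
      noncommuting Pi,
      (forall A, A \in S -> A \notin Pi -> exists2 B, B \in Pi & comm_mx A B)
    & #|` Pi| = 1%N -> commuting S].

Definition orthonormal_basis (R : realType) (d : nat)
    (b : 'I_d -> 'cV[R[i]]_d) : Prop :=
  forall j k, ((b j) ^t* *m b k) 0 0 = (j == k)%:R.

Definition eigenbasis (R : realType) (d : nat)
    (A : 'M[R[i]]_d) (b : 'I_d -> 'cV[R[i]]_d) : Prop :=
  orthonormal_basis b /\ forall j, exists l : R[i], A *m b j = l *: b j.

Definition projector (R : realType) (d : nat) (v : 'cV[R[i]]_d) : 'M[R[i]]_d :=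
  v *m v ^t*.

(* The order on R[i] makes [0 <= z] say that z is real and nonnegative.       *)
Definition possemidef (R : realType) (d : nat) (M : 'M[R[i]]_d) : Prop :=
  M \is hermsymmx /\ forall v : 'cV[R[i]]_d, 0 <= (v ^t* *m M *m v) 0 0.

Definition povm (R : realType) (d n : nat) (M : 'I_n -> 'M[R[i]]_d) : Prop :=
  (forall a, possemidef (M a)) /\ \sum_a M a = 1%:M.

Definition density_matrix (R : realType) (d : nat) (s : 'M[R[i]]_d) : Prop :=
  possemidef s /\ \tr s = 1.

(* [psi A j] is the j-th eigenvector of the observable A. It is an explicit   *)
(* parameter since a degenerate observable has many eigenbases. The sum is a  *)
(* real number of type R[i]; [complex.Re] only casts it to R.                 *)
Definition average_fidelity (R : realType) (d : nat) (Pi : {fset 'M[R[i]]_d})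
    (psi : 'M[R[i]]_d -> 'I_d -> 'cV[R[i]]_d)
    (n : nat) (M sigma : 'I_n -> 'M[R[i]]_d) : R :=
  complex.Re ((#|` Pi| * d)%N%:R^-1 *
    \sum_(A <- Pi) \sum_(j < d) \sum_(a < n)
      \tr (projector (psi A j) *m M a) * \tr (projector (psi A j) *m sigma a)).

Definition optimal_fidelity (R : realType) (d : nat) (Pi : {fset 'M[R[i]]_d})
    (psi : 'M[R[i]]_d -> 'I_d -> 'cV[R[i]]_d) : R :=
  sup [set f : R | exists (n : nat) (M : 'I_n -> 'M[R[i]]_d),
    povm M /\
    f = sup [set g : R | exists sigma : 'I_n -> 'M[R[i]]_d,
          (forall a, density_matrix (sigma a)) /\
          g = average_fidelity Pi psi M sigma]]%classic.

Definition incompatibility (R : realType) (d : nat) (Pi : {fset 'M[R[i]]_d})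
    (psi : 'M[R[i]]_d -> 'I_d -> 'cV[R[i]]_d) : R :=
  1 - optimal_fidelity Pi psi.

(* q is a value of Q for the set S, computed from some minimal noncommuting   *)
(* subset and some choice of eigenbases of its members.                       *)
Definition is_incompatibility (R : realType) (d : nat)
    (S : {fset 'M[R[i]]_d}) (q : R) : Prop :=
  exists (Pi : {fset 'M[R[i]]_d}) (psi : 'M[R[i]]_d -> 'I_d -> 'cV[R[i]]_d),
    [/\ minimal_noncommuting_subset S Pi,
        (forall A, A \in Pi -> eigenbasis A (psi A))
      & q = incompatibility Pi psi].

(* Main.v *)
Require Import Defs.
From mathcomp Require Import all_boot all_order all_algebra finmap.
From mathcomp Require Import sesquilinear spectral complex classical_sets reals.
From mathcomp Require Import ring.

(* Let p_k and r_l be the weights <a_k, M a_k> and <b_l, M b_l> of an effect M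
   in the eigenbases a, b of two noncommuting observables. Some a_j is parallel
   to no b_l, so c := prod_l (1 - |<a_j, b_l>|) > 0, and positivity of M gives
   p_k + r_l <= 2 tr M - c p_j for all k and l: for k = j this is
   p_j + r_l <= (1 + |<a_j, b_l>|) tr M, for k <> j it is p_j + p_k <= tr M.
   Whatever state is guessed, its weights in the two bases average these
   inequalities, so the two bases contribute at most 2 tr M - c p_j. Summing
   over the POVM, where the p_j add up to 1, bounds the fidelity by 1 - c / (N d),
   uniformly in the number of outcomes. The gap must be weighted by p_j, not by
   tr M, since noncommuting observables may share some eigenvectors. *)

Set Implicit Arguments.
Unset Strict Implicit.
Unset Printing Implicit Defensive.

Import Order.TTheory GRing.Theory Num.Theory.

Local Open Scope ring_scope.
Local Open Scope sesquilinear_scope.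

(** * Sesquilinear forms and traces of rank-one operators *)

Definition mxform (R : realType) (d : nat) (M : 'M[R[i]]_d)
  (x y : 'cV[R[i]]_d) : R[i] := (x ^t* *m M *m y) 0 0.

Lemma trmxC_mul (R : realType) (m n p : nat) (A : 'M[R[i]]_(m, n))
  (B : 'M[R[i]]_(n, p)) : (A *m B) ^t* = B ^t* *m A ^t*.
Proof. by rewrite trmx_mul map_mxM. Qed.

Lemma dot_conj (R : realType) (d : nat) (x y : 'cV[R[i]]_d) :
  (y ^t* *m x) 0 0 = ((x ^t* *m y) 0 0)^*.
Proof.
have -> : y ^t* *m x = (x ^t* *m y) ^t* by rewrite trmxC_mul trmxCK.
by rewrite [LHS]mxE mxE.
Qed.

Lemma mxtrace_outer (R : realType) (d : nat) (x y : 'cV[R[i]]_d) :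
  \tr (x *m y ^t*) = (y ^t* *m x) 0 0.
Proof. by rewrite mxtrace_mulC /mxtrace big_ord1. Qed.

Lemma mxtrace_rank1 (R : realType) (d : nat) (M : 'M[R[i]]_d)
  (x y : 'cV[R[i]]_d) : \tr (x *m y ^t* *m M) = mxform M y x.
Proof. by rewrite -mulmxA mxtrace_mulC /mxtrace big_ord1. Qed.

Lemma mxtrace_rank1_conj (R : realType) (d : nat) (M : 'M[R[i]]_d)
  (x y z w : 'cV[R[i]]_d) :
  \tr (x *m y ^t* *m M *m (z *m w ^t*)) = mxform M y z * (w ^t* *m x) 0 0.
Proof.
have -> : x *m y ^t* *m M *m (z *m w ^t*) = x *m (y ^t* *m M *m z) *m w ^t*.
  by rewrite !mulmxA.
by rewrite [_ *m z]mx11_scalar -mulmxA mul_scalar_mx -scalemxAr mxtraceZ mxtrace_outer.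
Qed.

Lemma mxform_sqr (R : realType) (d : nat) (M : 'M[R[i]]_d)
  (x y : 'cV[R[i]]_d) (a b : R[i]) :
  mxform M (a *: x - b *: y) (a *: x - b *: y) =
  a * a^* * mxform M x x + b * b^* * mxform M y y
  - b * a^* * mxform M x y - a * b^* * mxform M y x.
Proof.
have abC : (a *: x - b *: y) ^t* = a^* *: x ^t* - b^* *: y ^t*.
  by apply/matrixP => j k; rewrite !mxE rmorphB !rmorphM.
rewrite /mxform abC !mulmxBl !mulmxBr -!scalemxAl -!scalemxAr !mxE; ring.
Qed.

(** Every diagonal entry of [Y *m M *m Y ^t*] is the form of [M] at the adjoint of a row of [Y]. *)
Lemma possemidef_conj (R : realType) (d : nat) (M Y : 'M[R[i]]_d) :
  possemidef M -> 0 <= \tr (Y *m M *m Y ^t*).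
Proof.
case=> _ M0; apply: sumr_ge0 => i _.
suff <- : (row i Y *m M *m (row i Y) ^t*) 0 0 = (Y *m M *m Y ^t*) i i.
  by rewrite -{1}[row i Y]trmxCK; apply: M0.
by rewrite -row_mul !mxE; apply: eq_bigr => k _; rewrite !mxE.
Qed.

(** The constant is the largest eigenvalue of the sum of the projectors onto [v] and [u]; the
    argument uses only positivity of [M], with no diagonalisation. *)
Lemma mxform_pair_le (R : realType) (d : nat) (M : 'M[R[i]]_d)
  (v u : 'cV[R[i]]_d) :
  possemidef M -> (v ^t* *m v) 0 0 = 1 -> (u ^t* *m u) 0 0 = 1 ->
  mxform M v v + mxform M u u <= (1 + `|(v ^t* *m u) 0 0|) * \tr M.
Proof.
move=> M0 v1 u1; set g := (v ^t* *m u) 0 0.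
have gC : (u ^t* *m v) 0 0 = g^* := dot_conj v u.
set p := mxform M v v; set r := mxform M u u.
set k := 1 + `|g|.
have k0 : 0 < k by rewrite ltr_pwDl.
have kC : k^* = k by rewrite geC0_conj // ltW.
(* With G the sum of the two projectors, G^2 <= k G, hence
   0 <= (k - G)^2 <= k (k - G); both steps are paired with M. *)
pose Y : 'M[R[i]]_d := k%:M - v *m v ^t* - u *m u ^t*.
have YC : Y ^t* = Y.
  rewrite /Y !linearB /= !map_mxB !trmxC_mul !trmxCK tr_scalar_mx map_scalar_mx.
  by congr (_%:M - _ - _).
have := possemidef_conj Y M0; rewrite YC.
have -> : \tr (Y *m M *m Y) = k ^+ 2 * \tr M - k *+ 2 * (p + r) + (p + r)
    + mxform M v u * g^* + mxform M u v * g.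
  rewrite {2}/Y !mulmxBr mul_mx_scalar.
  have tB (A B : 'M[R[i]]_d) : \tr (A - B) = \tr A - \tr B by exact: raddfB.
  rewrite /Y !mulmxBl !mul_scalar_mx -!scalemxAl !(tB, mxtraceZ).
  rewrite !mxtrace_rank1_conj !mxtrace_rank1.
  rewrite ![\tr (M *m _)]mxtrace_mulC !mxtrace_rank1 v1 u1 gC -/g -/p -/r.
  ring.
(* For this vector [w], the operator [w w^*] equals [|g| (k G - G^2)], so positivity of [M] at [w]
   is [G^2 <= k G] paired with [M], up to the factor [|g|]. *)
have [_ /(_ (g *: v - `|g| *: u))] := M0; rewrite -/(mxform _ _ _) mxform_sqr.
rewrite -/p -/r -normCK geC0_conj //.
have -> : `|g| ^+ 2 * p + `|g| * `|g| * r - `|g| * g^* * mxform M v u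
   - g * `|g| * mxform M u v = `|g| * (`|g| * (p + r) - (mxform M v u * g^* + mxform M u v * g)).
  by ring.
set X := _ + _ * g => hX hY.
have {}hX : X <= `|g| * (p + r).
  (* The factor [|g|] cannot be cancelled when [g = 0], but then both sides vanish. *)
  have [g0|g0] := eqVneq g 0; first by rewrite /X g0 conjC0 normr0 !(mulr0, mul0r) addr0.
  by move: hX; rewrite pmulr_rge0 ?normr_gt0 // subr_ge0.
have : 0 <= k * (k * \tr M - (p + r)).
  apply: le_trans hY _; rewrite -subr_ge0.
  have -> : k * (k * \tr M - (p + r)) - (k ^+ 2 * \tr M - k *+ 2 * (p + r) + (p + r) +
     mxform M v u * g^* + mxform M u v * g) = `|g| * (p + r) - X by rewrite /X /k; ring.
  by rewrite subr_ge0.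
by rewrite pmulr_rge0 // subr_ge0.
Qed.

(** * Projectors, orthonormal bases and shared eigenvectors *)

Lemma mxform_projector (R : realType) (d : nat) (v w : 'cV[R[i]]_d) :
  mxform (projector v) w w = `|(v ^t* *m w) 0 0| ^+ 2.
Proof.
rewrite /mxform /projector mulmxA -mulmxA mxE big_ord1 (dot_conj v w) mulrC.
by rewrite normCK.
Qed.

Lemma mxtrace_projector_mul (R : realType) (d : nat) (M : 'M[R[i]]_d)
  (v : 'cV[R[i]]_d) : \tr (projector v *m M) = mxform M v v.
Proof. exact: mxtrace_rank1. Qed.

Lemma projectorC (R : realType) (d : nat) (v : 'cV[R[i]]_d) :
  (projector v) ^t* = projector v.
Proof. by rewrite trmxC_mul trmxCK. Qed.

Lemma possemidef_projector (R : realType) (d : nat) (v : 'cV[R[i]]_d) :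
  possemidef (projector v).
Proof.
split=> [|w]; first by apply/is_hermitianmxP; rewrite expr0 scale1r projectorC.
by rewrite -/(mxform _ w w) mxform_projector exprn_ge0.
Qed.

Section Basis.
Variables (R : realType) (d : nat) (b : 'I_d -> 'cV[R[i]]_d).
Hypothesis b_on : orthonormal_basis b.

Lemma sum_projector : \sum_j projector (b j) = 1%:M.
Proof.
pose U : 'M[R[i]]_d := \matrix_(i, j) b j i 0.
have UU : U ^t* *m U = 1%:M.
  apply/matrixP => j k; rewrite [RHS]mxE -b_on !mxE.
  by apply: eq_bigr => i _; rewrite !mxE.
(* A left inverse of a square matrix is a right inverse: orthonormality of the columns of [U]
   becomes completeness. *)
rewrite -(mulmx1C UU); apply/matrixP => i k; rewrite summxE mxE.
by apply: eq_bigr => j _; rewrite !mxE big_ord1 !mxE.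
Qed.

Lemma sum_mxform (M : 'M[R[i]]_d) : \sum_j mxform M (b j) (b j) = \tr M.
Proof.
rewrite -[in RHS](mul1mx M) -sum_projector mulmx_suml raddf_sum.
by apply: eq_bigr => j _; apply/esym/mxtrace_rank1.
Qed.

Lemma basis_expansion (v : 'cV[R[i]]_d) :
  v = \sum_l ((b l) ^t* *m v) 0 0 *: b l.
Proof.
rewrite -[LHS]mul1mx -sum_projector mulmx_suml; apply: eq_bigr => l _.
by rewrite /projector -mulmxA [X in _ *m X]mx11_scalar mul_mx_scalar.
Qed.

Lemma mxtrace_projector j : \tr (projector (b j)) = 1.
Proof. by rewrite mxtrace_outer b_on eqxx. Qed.

Lemma parseval (v : 'cV[R[i]]_d) :
  \sum_l `|(v ^t* *m b l) 0 0| ^+ 2 = (v ^t* *m v) 0 0.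
Proof.
under eq_bigr do rewrite -mxform_projector.
by rewrite sum_mxform mxtrace_outer.
Qed.

Lemma density_projector j : density_matrix (projector (b j)).
Proof. by split; [exact: possemidef_projector | exact: mxtrace_projector]. Qed.

Lemma povm_projector : povm (fun j => projector (b j)).
Proof. by split=> [j|]; [exact: possemidef_projector | exact: sum_projector]. Qed.

(** By Parseval, an overlap of modulus at least 1 exhausts the norm of [v], so all other
    coefficients vanish. *)
Lemma parallel_basis_vector (v : 'cV[R[i]]_d) l :
  (v ^t* *m v) 0 0 = 1 -> 1 <= `|(v ^t* *m b l) 0 0| ->
  v = ((b l) ^t* *m v) 0 0 *: b l.
Proof.
move=> v1 gl; rewrite {1}[v]basis_expansion (bigD1 l) //= big1 ?addr0 // => k kl.
have := parseval v; rewrite v1 (bigD1 l) //= => /eqP.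
rewrite addrC eq_sym -subr_eq => /eqP sum_rest.
have /eqP : \sum_(i < d | i != l) `|(v ^t* *m b i) 0 0| ^+ 2 = 0.
  apply: le_anti; rewrite -{1}sum_rest subr_le0 exprn_ege1 //=.
  by apply: sumr_ge0 => i _; rewrite exprn_ge0.
rewrite psumr_eq0 => [|i _]; last by rewrite exprn_ge0.
move=> /allP /(_ k (mem_index_enum _)); rewrite kl /= sqrf_eq0 normr_eq0.
by move=> /eqP vk0; rewrite (dot_conj v) vk0 conjC0 scale0r.
Qed.

End Basis.

(** Otherwise each [a j] is parallel to some [b l], hence an eigenvector of both observables, and
    [A *m B] agrees with [B *m A] on a basis. *)
Lemma unshared_eigenvector (R : realType) (d : nat) (A B : 'M[R[i]]_d)
  (a b : 'I_d -> 'cV[R[i]]_d) :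
  eigenbasis A a -> eigenbasis B b -> ~ comm_mx A B ->
  exists j, forall l, `|((a j) ^t* *m b l) 0 0| < 1.
Proof.
move=> [a_on a_eig] [b_on b_eig] nAB.
have [/existsP[j /forallP jP]|] :=
  boolP [exists j, [forall l, `|((a j) ^t* *m b l) 0 0| < 1]]; first by exists j.
rewrite negb_exists => /forallP noj; case: nAB.
have comm_j j : A *m B *m a j = B *m A *m a j.
  have := noj j; rewrite negb_forall => /existsP[l].
  rewrite -real_leNgt ?normr_real ?real1 // => gl.
  have a1 : ((a j) ^t* *m a j) 0 0 = 1 by rewrite a_on eqxx.
  have ab := parallel_basis_vector b_on a1 gl.
  have [y By] : exists y, B *m a j = y *: a j.
    have [y By] := b_eig l; exists y.
    by rewrite ab -scalemxAr By scalerA mulrC -scalerA.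
  have [x Ax] := a_eig j.
  by rewrite -!mulmxA Ax By -!scalemxAr Ax By !scalerA mulrC.
rewrite /comm_mx -[LHS]mulmx1 -[RHS]mulmx1 -(sum_projector a_on) !mulmx_sumr.
by apply: eq_bigr => j _; rewrite /projector !mulmxA comm_j.
Qed.

(** * Bounds for a single measurement outcome *)

(** Up to the factor [1 / (N d)], this is what one observable and one outcome, with effect [M] and
    guess [s], add to the average fidelity. *)
Definition score (R : realType) (d : nat) (b : 'I_d -> 'cV[R[i]]_d)
  (M s : 'M[R[i]]_d) : R[i] :=
  \sum_j \tr (projector (b j) *m M) * \tr (projector (b j) *m s).

Section Score.
Variables (R : realType) (d : nat) (M s : 'M[R[i]]_d).
Hypotheses (M0 : possemidef M) (s_dm : density_matrix s).

Lemma mxform_ge0 (N : 'M[R[i]]_d) v : possemidef N -> 0 <= mxform N v v.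
Proof. by case=> _; apply. Qed.

Lemma mxform_le_tr (b : 'I_d -> 'cV[R[i]]_d) k :
  orthonormal_basis b -> mxform M (b k) (b k) <= \tr M.
Proof.
move=> b_on; rewrite -(sum_mxform b_on M) (bigD1 k) //= lerDl.
by apply: sumr_ge0 => i _; apply: mxform_ge0.
Qed.

(** The weights of [s] form a probability distribution, and each weight of [M] is at most its
    trace. *)
Lemma score_le_tr (b : 'I_d -> 'cV[R[i]]_d) :
  orthonormal_basis b -> score b M s <= \tr M.
Proof.
move=> b_on; rewrite /score -[leRHS]mulr1 -s_dm.2 -(sum_mxform b_on s) mulr_sumr.
apply: ler_sum => j _; rewrite !mxtrace_projector_mul; apply: ler_wpM2r.
  exact: mxform_ge0 s_dm.1.
exact: mxform_le_tr.
Qed.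

Lemma score_pair (a b : 'I_d -> 'cV[R[i]]_d) j (c : R[i]) :
  orthonormal_basis a -> orthonormal_basis b -> 0 <= c ->
  (forall l, c <= 1 - `|((a j) ^t* *m b l) 0 0|) ->
  c * mxform M (a j) (a j) <= \tr M *+ 2 - (score a M s + score b M s).
Proof.
move=> a_on b_on c0 cP.
have M_ge0 v := mxform_ge0 v M0.
have m0 : 0 <= \tr M by rewrite -(sum_mxform a_on); apply: sumr_ge0.
have pair k l : mxform M (a k) (a k) + mxform M (b l) (b l) <=
    \tr M *+ 2 - c * mxform M (a j) (a j).
  have [->|kj] := eqVneq k j.
    apply: le_trans (mxform_pair_le M0 _ _) _; rewrite ?a_on ?b_on ?eqxx //.
    rewrite -subr_ge0; set g := `|_|; set p := mxform _ _ _; set m := \tr M.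
    have -> : m *+ 2 - c * p - (1 + g) * m = (1 - g - c) * m + c * (m - p) by ring.
    by rewrite addr_ge0 // mulr_ge0 // subr_ge0 ?cP ?mxform_le_tr.
  (* Since [c <= 1], the deficit is covered by the weight on [a j], which shares [tr M] with the
     weight on [a k]. *)
  rewrite lerBrDr addrAC mulr2n; apply: lerD; last exact: mxform_le_tr.
  rewrite -(sum_mxform a_on) (bigD1 k) //= lerD2l (bigD1 j) 1?eq_sym //=.
  apply: ler_wpDr; first exact: sumr_ge0.
  rewrite ler_piMl //; apply: le_trans (cP j) _.
  by rewrite lerBlDr lerDl.
rewrite lerBrDr addrC -lerBrDr.
set X := _ - _ in pair *.
have q1 (e : 'I_d -> 'cV[R[i]]_d) : orthonormal_basis e ->
    \sum_k mxform s (e k) (e k) = 1.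
  by move=> e_on; rewrite sum_mxform // s_dm.2.
(* Under the product of the two distributions given by [s], the sum of the scores is the expectation
   of the pair weights, and the constant [X] is its own expectation. *)
have -> : score a M s + score b M s = \sum_k \sum_l
    mxform s (a k) (a k) * mxform s (b l) (b l) *
    (mxform M (a k) (a k) + mxform M (b l) (b l)).
  have scoreE e : score e M s =
      \sum_k mxform s (e k) (e k) * mxform M (e k) (e k).
    by apply: eq_bigr => k _; rewrite !mxtrace_projector_mul mulrC.
  rewrite !scoreE -[X in X + _]mulr1 -[X in _ + X]mul1r -{1}(q1 b b_on) -(q1 a a_on).
  rewrite !big_distrlr -big_split /=; apply: eq_bigr => k _.
  by rewrite -big_split /=; apply: eq_bigr => l _; ring.
have -> : X = \sum_k \sum_l mxform s (a k) (a k) * mxform s (b l) (b l) * X.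
  rewrite -[LHS]mul1r -[in LHS](mulr1 1) -{1}(q1 a a_on) -(q1 b b_on).
  rewrite big_distrlr /= mulr_suml; apply: eq_bigr => k _.
  by rewrite mulr_suml.
do 2![apply: ler_sum => ? _]; apply: ler_wpM2l; last exact: pair.
by rewrite mulr_ge0 //; apply: mxform_ge0 s_dm.1.
Qed.

End Score.

(** * Bounds on sums over a finite set *)

Lemma sum_fset_le (K : choiceType) (T : numDomainType) (F : {fset K})
  (f : K -> T) (m : T) :
  (forall A, A \in F -> f A <= m) -> \sum_(A <- F) f A <= m *+ #|` F|.
Proof.
move=> f_le; have -> : m *+ #|` F| = \sum_(A <- F) m.
  by rewrite big_const_seq count_predT iter_addr_0.
by rewrite big_seq [leRHS]big_seq; apply: ler_sum.
Qed.

(** One pair with deficit [e] suffices; the remaining terms get the crude bound [m]. *)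
Lemma sum_fset_le_pair (K : choiceType) (T : numDomainType) (F : {fset K})
  (f : K -> T) (m e : T) (A B : K) :
  (forall C, C \in F -> f C <= m) -> A \in F -> B \in F -> A != B ->
  e <= m *+ 2 - (f A + f B) -> \sum_(C <- F) f C <= m *+ #|` F| - e.
Proof.
move=> f_le AF BF AB e_le.
have BFA : B \in (F `\ A)%fset by rewrite !inE eq_sym AB.
rewrite (big_fsetD1 A) //= (big_fsetD1 B) //= (cardfsD1 A) AF (cardfsD1 B) BFA.
rewrite addrA addnA mulrnDr [leRHS]addrAC; apply: lerD.
  by move: e_le; rewrite !lerBrDr [e + _]addrC.
apply: (@sum_fset_le K T _ f m) => C; by rewrite !inE => /and3P[_ _ /f_le].
Qed.

(** * Average and optimal fidelity *)

Section Fidelity.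
Variables (R : realType) (d : nat) (Pi : {fset 'M[R[i]]_d}).
Variable psi : 'M[R[i]]_d -> 'I_d -> 'cV[R[i]]_d.
Hypothesis psi_on : forall A, A \in Pi -> orthonormal_basis (psi A).
Hypotheses (d_gt0 : (0 < d)%N) (Pi_n0 : (0 < #|` Pi|)%N).

Lemma average_fidelityE n (M s : 'I_n -> 'M[R[i]]_d) :
  average_fidelity Pi psi M s =
  complex.Re ((#|` Pi| * d)%N%:R^-1 *
    \sum_(a < n) \sum_(A <- Pi) score (psi A) (M a) (s a)).
Proof.
rewrite /average_fidelity [in RHS]exchange_big /=; congr (complex.Re (_ * _)).
by apply: eq_bigr => A _; rewrite exchange_big.
Qed.

Lemma povm_mxtrace n (M : 'I_n -> 'M[R[i]]_d) :
  povm M -> \sum_a \tr (M a) = d%:R.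
Proof. by case=> _ M1; rewrite -raddf_sum M1 /= mxtrace1. Qed.

Lemma average_fidelity_le n (M s : 'I_n -> 'M[R[i]]_d) (c : R[i]) :
  (\sum_(a < n) \sum_(A <- Pi) score (psi A) (M a) (s a) <=
     (#|` Pi| * d)%N%:R - c) ->
  average_fidelity Pi psi M s <= 1 - complex.Re (c / (#|` Pi| * d)%N%:R).
Proof.
set D : R[i] := _%:R => le_c.
have D0 : 0 < D by rewrite ltr0n muln_gt0 Pi_n0.
rewrite average_fidelityE -/D.
have : D^-1 * \sum_(a < n) \sum_(A <- Pi) score (psi A) (M a) (s a) <= 1 - c / D.
  by rewrite mulrC ler_pdivrMr // mulrBl mul1r divfK ?gt_eqF.
(* An inequality in [R[i]] means equal imaginary parts and ordered real parts. *)
rewrite lecE => /andP[_ le_Re]; apply: le_trans le_Re _.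
by rewrite raddfB.
Qed.

Lemma average_fidelity_le1 n (M s : 'I_n -> 'M[R[i]]_d) :
  povm M -> (forall a, density_matrix (s a)) ->
  average_fidelity Pi psi M s <= 1.
Proof.
(* This is the case of deficit [c = 0] of the previous bound. *)
move=> M_povm s_dm; rewrite -[1]subr0 -[0 in leRHS](raddf0 (@complex.Re R)).
rewrite -(mul0r (#|` Pi| * d)%N%:R^-1); apply: average_fidelity_le.
rewrite subr0 natrM -(povm_mxtrace M_povm) mulr_sumr; apply: ler_sum => a _.
rewrite mulr_natl; apply: sum_fset_le => A /psi_on A_on.
by apply: score_le_tr => //; case: M_povm.
Qed.

Lemma average_fidelity_gap n (M s : 'I_n -> 'M[R[i]]_d) A B j (c : R[i]) :
  A \in Pi -> B \in Pi -> A != B -> 0 <= c ->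
  (forall l, c <= 1 - `|((psi A j) ^t* *m psi B l) 0 0|) ->
  povm M -> (forall a, density_matrix (s a)) ->
  average_fidelity Pi psi M s <= 1 - complex.Re (c / (#|` Pi| * d)%N%:R).
Proof.
move=> API BPi AB c0 cP M_povm s_dm; apply: average_fidelity_le.
have M_ge0 a : possemidef (M a) by case: M_povm.
have [A_on B_on] := (psi_on API, psi_on BPi).
(* The effects sum to the identity, so their weights on the unit vector [psi A j] sum to 1. *)
have c1 : \sum_a c * mxform (M a) (psi A j) (psi A j) = c.
  rewrite -mulr_sumr -[RHS]mulr1 -(mxtrace_projector A_on j); congr (_ * _).
  rewrite -[in RHS](mulmx1 (projector _)) -M_povm.2 mulmx_sumr raddf_sum.
  by apply: eq_bigr => a _; apply/esym/mxtrace_projector_mul.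
rewrite natrM -(povm_mxtrace M_povm) mulr_sumr -c1 -sumrB; apply: ler_sum => a _.
rewrite mulr_natl; apply: (sum_fset_le_pair _ API BPi AB) => [C /psi_on C_on|].
  exact: score_le_tr.
exact: score_pair.
Qed.

Lemma optimal_fidelity_le (e : R) :
  (forall n (M s : 'I_n -> 'M[R[i]]_d), povm M ->
     (forall a, density_matrix (s a)) -> average_fidelity Pi psi M s <= e) ->
  optimal_fidelity Pi psi <= e.
Proof.
move=> avg_le.
have [A APi] : exists A, A \in Pi by apply/fset0Pn; rewrite -cardfs_gt0.
have A_on := psi_on APi.
apply: ge_sup.
  (* An upper bound passes to [sup] only for inhabited sets: an eigenbasis measurement serves here,
     a constant guess for the inner set. *)
  by eexists; exists d, (fun j => projector (psi A j)); split; [exact: povm_projector|].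
move=> _ [n [M [M_povm ->]]]; apply: ge_sup.
  exists (average_fidelity Pi psi M (fun=> projector (psi A (Ordinal d_gt0)))).
  exists (fun=> projector (psi A (Ordinal d_gt0))); split=> // _.
  exact: density_projector.
by move=> _ [s [s_dm ->]]; apply: avg_le.
Qed.

Lemma le_optimal_fidelity n (M s : 'I_n -> 'M[R[i]]_d) :
  povm M -> (forall a, density_matrix (s a)) ->
  average_fidelity Pi psi M s <= optimal_fidelity Pi psi.
Proof.
move=> M_povm s_dm.
(* [sup] dominates the members of a set only if the set is bounded above; the bound 1 serves for
   both suprema. *)
have le1 n' (M' s' : 'I_n' -> 'M[R[i]]_d) : povm M' ->
    (forall a, density_matrix (s' a)) -> average_fidelity Pi psi M' s' <= 1.
  exact: average_fidelity_le1.
set E := [set g : R | exists s' : 'I_n -> 'M[R[i]]_d,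
  (forall a, density_matrix (s' a)) /\ g = average_fidelity Pi psi M s']%classic.
have /le_trans : average_fidelity Pi psi M s <= sup E.
  apply: ub_le_sup; last by exists s.
  by exists 1 => _ [s' [s'_dm ->]]; apply: le1.
apply; apply: ub_le_sup; last by exists n, M.
exists 1 => _ [n' [M' [M'_povm ->]]]; apply: ge_sup.
  have [A APi] : exists A, A \in Pi by apply/fset0Pn; rewrite -cardfs_gt0.
  pose rho := projector (psi A (Ordinal d_gt0)).
  exists (average_fidelity Pi psi M' (fun=> rho)), (fun=> rho); split=> // _.
  exact: density_projector (psi_on APi) _.
by move=> _ [s' [s'_dm ->]]; apply: le1.
Qed.

Lemma optimal_fidelity_le1 : optimal_fidelity Pi psi <= 1.
Proof. by apply: optimal_fidelity_le => n M s; apply: average_fidelity_le1. Qed.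

End Fidelity.

(** * The commuting and the noncommuting case *)

Lemma optimal_fidelity_single (R : realType) (d : nat) (A : 'M[R[i]]_d)
  (psi : 'M[R[i]]_d -> 'I_d -> 'cV[R[i]]_d) :
  (0 < d)%N -> orthonormal_basis (psi A) -> optimal_fidelity [fset A]%fset psi = 1.
Proof.
move=> d_gt0 A_on.
have psi_on B : B \in [fset A]%fset -> orthonormal_basis (psi B).
  by rewrite inE => /eqP ->.
have c_gt0 : (0 < #|` [fset A]%fset|)%N by rewrite cardfs1.
apply: le_anti; rewrite optimal_fidelity_le1 //=.
(* Measuring in the eigenbasis and guessing the eigenvector found identifies every signal with
   certainty. *)
pose P j := projector (psi A j).
have PP j k : \tr (P j *m P k) = (j == k)%:R.
  rewrite mxtrace_projector_mul mxform_projector A_on eq_sym.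
  by case: eqP; rewrite /= ?normr1 ?normr0 ?expr1n ?expr0n.
have <- : average_fidelity [fset A]%fset psi P P = 1.
  rewrite average_fidelityE cardfs1 mul1n.
  have -> : \sum_(a < d) \sum_(B <- [fset A]%fset) score (psi B) (P a) (P a) = d%:R.
    rewrite -[d in RHS]card_ord -sumr_const; apply: eq_bigr => a _.
    rewrite big_seq_fset1 /score (bigD1 a) //= PP eqxx mulr1 big1 ?addr0 // => j ja.
    by rewrite PP (negbTE ja) mul0r.
  by rewrite mulVf // pnatr_eq0 -lt0n.
apply: le_optimal_fidelity => //; first exact: povm_projector.
by move=> a; apply: density_projector.
Qed.

Lemma optimal_fidelity_noncommuting (R : realType) (d : nat)
  (Pi : {fset 'M[R[i]]_d}) (psi : 'M[R[i]]_d -> 'I_d -> 'cV[R[i]]_d) A B :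
  (0 < d)%N -> (forall C, C \in Pi -> eigenbasis C (psi C)) ->
  A \in Pi -> B \in Pi -> A != B -> ~ comm_mx A B -> optimal_fidelity Pi psi < 1.
Proof.
move=> d_gt0 psi_eig APi BPi AB nAB.
have psi_on C : C \in Pi -> orthonormal_basis (psi C) by move=> /psi_eig[].
have Pi_gt0 : (0 < #|` Pi|)%N by rewrite cardfs_gt0; apply/fset0Pn; exists A.
have [j jP] := unshared_eigenvector (psi_eig _ APi) (psi_eig _ BPi) nAB.
pose g l := 1 - `|((psi A j) ^t* *m psi B l) 0 0|.
have g_gt0 l : 0 < g l by rewrite subr_gt0.
have g_le1 l : g l <= 1 by rewrite lerBlDr lerDl.
(* With all factors in [(0, 1]], the product is a positive lower bound of each and replaces their
   minimum. *)
pose c := \prod_l g l.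
have c_gt0 : 0 < c by apply: prodr_gt0.
have c_le l : c <= g l.
  rewrite /c (bigD1 l) //= ler_piMr ?(ltW (g_gt0 l)) //.
  by apply: prodr_ile1 => k _; rewrite g_le1 ltW.
apply: (@le_lt_trans _ _ (1 - complex.Re (c / (#|` Pi| * d)%N%:R))).
  apply: optimal_fidelity_le => // n M s M_povm s_dm.
  exact: (average_fidelity_gap psi_on d_gt0 Pi_gt0 APi BPi AB (ltW c_gt0) c_le).
have : 0 < c / (#|` Pi| * d)%N%:R by rewrite divr_gt0 // ltr0n muln_gt0 Pi_gt0.
by rewrite ltcE => /andP[_ ?]; rewrite ltrBlDr ltrDl.
Qed.

Local Open Scope complex_scope.
Local Open Scope fset_scope.

Theorem proposition1 (R : realType) (d : nat) (hd : (0 < d)%N)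
    (S : {fset 'M[R[i]]_d}) (hS : observables S) (hS0 : S != fset0)
    (Q : R) (hQ : is_incompatibility S Q) :
  (commuting S -> Q = 0) /\ (~ commuting S -> 0 < Q).
Proof.
have [Pi [psi [[sub_Pi nc_Pi cover_Pi one_Pi] psi_eig ->]]] := hQ.
(* A member of [S] outside [Pi] commutes with some member of [Pi], so [Pi] is inhabited either
   way. *)
have [A APi] : exists A, A \in Pi.
  have [A AS] := fset0Pn _ hS0; have [APi|/(cover_Pi A AS)[B BPi _]] := boolP (A \in Pi).
    by exists A.
  by exists B.
split=> [comS|ncomS].
  have -> : Pi = [fset A]%fset.
    apply/fsetP => B; rewrite inE; apply/idP/eqP => [BPi|->//].
    apply/eqP/negPn/negP => BA; apply: (nc_Pi _ _ BPi APi BA).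
    by apply: comS; apply: (fsubsetP sub_Pi).
  by rewrite /incompatibility optimal_fidelity_single ?subrr //; case: (psi_eig A APi).
rewrite subr_gt0.
(* If [Pi] were a singleton, the convention on [N = 1] would make [S] commuting. *)
have [B] : exists B, B \in (Pi `\ A)%fset.
  apply/fset0Pn; apply/eqP => PiA0; apply/ncomS/one_Pi.
  by rewrite (cardfsD1 A) APi PiA0 cardfs0.
rewrite !inE => /andP[BA BPi].
exact: (optimal_fidelity_noncommuting hd psi_eig BPi APi BA (nc_Pi _ _ BPi APi BA)).
Qed.
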